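(* Let $F$ be a finite field with $|F|=q$, and let $V$ be a vector space over $F$ with $\dim(V)=n$. If $n$ is odd, then $$\chi(G(V))=\sum_{i=1}^{\lfloor n/2\rfloor} \begin{bmatrix} n \\ i \end{bmatrix}_{q}.$$
   Context: For a finite-dimensional vector space $V$ over a finite field, the intersection graph of subspaces $G(V)$ is the simple graph whose vertices are the proper nontrivial subspaces of $V$ (i.e. subspaces $W$ with $W\neq 0$ and $W\neq V$), two distinct vertices being adjacent if and only if the corresponding subspaces have nonzero intersection. A proper vertex coloring of a graph $G$ is a function $f$ on the vertex set with $f(u)\neq f(v)$ for any adjacent vertices $u,v$; the chromatic number $\chi(G)$ is the minimum $k$ such that there is a proper vertex coloring $f$ with $|f(V(G))|=k$, where $V(G)$ here denotes the vertex set of $G$. For $t\in\{1,\dots,n\}$, $\begin{bmatrix} n \\ t \end{bmatrix}_{q}=\prod_{0\leq i<t}\frac{q^{n-i}-1}{q^{t-i}-1}$ is the number of $t$-dimensional subspaces of an $n$-dimensional vector space over the field with $q$ elements; also $\begin{bmatrix} n \\ 0 \end{bmatrix}_{q}=1$ and $\begin{bmatrix} n \\ t \end{bmatrix}_{q}=0$ if $t\notin\{0,1,\dots,n\}$. *)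

(* Defs.v *)
From HB Require Import structures.
From mathcomp Require Import all_boot all_order all_algebra.

Set Implicit Arguments.
Unset Strict Implicit.
Unset Printing Implicit Defensive.

Import GRing.Theory.

Record sgraph := SGraph {
  vertex :> finType;
  adj : rel vertex;
  adj_sym : symmetric adj;
  adj_irr : irreflexive adj
}.

Section Coloring.
Variable G : sgraph.

Definition proper_coloring (C : eqType) (f : G -> C) : bool :=
  [forall u : G, forall v : G, adj u v ==> (f u != f v)].

Definition ncolors (C : eqType) (f : G -> C) : nat := size (undup (codom f)).

(* Colors are taken in a fixed set with as many elements as there are
   vertices; chrom_numP shows that this loses no generality. *)
Definition exact_colorable (k : nat) : bool :=
  [exists f : {ffun G -> 'I_#|G|}, proper_coloring f && (ncolors f == k)].

Lemma exact_colorable_of (C : eqType) (f : G -> C) :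
  proper_coloring f -> exact_colorable (ncolors f).
Proof.
move=> /forallP pf.
have in_f x : f x \in undup (codom f) by rewrite mem_undup codom_f.
have lt_f x : index (f x) (undup (codom f)) < #|G|.
  apply: leq_trans (_ : size (undup (codom f)) <= _); first by rewrite index_mem.
  by rewrite -(size_codom f) size_undup.
pose g := [ffun x => Ordinal (lt_f x)].
have gE x y : (g x == g y) = (f x == f y).
  rewrite !ffunE -val_eqE /=; apply/eqP/eqP => [e|-> //].
  by rewrite -(nth_index (f x) (in_f x)) e nth_index.
apply/existsP; exists g; apply/andP; split.
  by apply/forallP => u; apply/forallP => v; rewrite gE; apply: (forallP (pf u)).
have h_inj : {in undup (codom g) &,
    injective (fun i : 'I_#|G| => nth None (map Some (undup (codom f))) i)}.
  move=> i j; rewrite !mem_undup => /codomP[x ->] /codomP[y ->].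
  rewrite !ffunE /= !(nth_map (f x)) ?index_mem // !nth_index // => -[e].
  by apply: val_inj; rewrite /= e.
rewrite /ncolors -(size_map (fun i : 'I_#|G| => nth None (map Some (undup (codom f))) i)).
rewrite -[X in _ == X](size_map Some); apply/eqP/perm_size/uniq_perm.
- by rewrite map_inj_in_uniq ?undup_uniq.
- by rewrite map_inj_uniq ?undup_uniq // => ? ? [].
move=> z; apply/mapP/mapP => [[i]|[c]]; rewrite mem_undup => /codomP[x ->] ->.
  exists (f x) => //.
  by rewrite ffunE /= (nth_map (f x)) ?index_mem // nth_index.
exists (g x); first by rewrite mem_undup codom_f.
by rewrite ffunE /= (nth_map (f x)) ?index_mem // nth_index.
Qed.

Lemma exact_colorable_ex : exists k, exact_colorable k.
Proof.
exists (ncolors (fun v : G => v)); apply: exact_colorable_of.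
apply/forallP => u; apply/forallP => v; apply/implyP.
by apply: contraTneq => ->; rewrite adj_irr.
Qed.

Definition chrom_num : nat := ex_minn exact_colorable_ex.

Lemma chrom_numP :
  (exists f : G -> nat, proper_coloring f /\ ncolors f = chrom_num) /\
  (forall (C : eqType) (f : G -> C), proper_coloring f -> chrom_num <= ncolors f).
Proof.
rewrite /chrom_num; case: ex_minnP => k /existsP[f /andP[pf /eqP nf]] min_k.
split; last by move=> C g pg; apply/min_k/exact_colorable_of.
exists (fun v => val (f v)); split.
  by apply/forallP => u; apply/forallP => v; apply: (forallP (forallP pf u)).
rewrite -nf /ncolors /codom /image_mem.
rewrite (map_comp val f) undup_map_inj ?size_map //; exact: val_inj.
Qed.

End Coloring.

Import VectorInternalTheory.

HB.instance Definition _ (F : finFieldType) (V : vectType F) :=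
  [Countable of {vspace V} by <:].
HB.instance Definition _ (F : finFieldType) (V : vectType F) :=
  [Finite of {vspace V} by <:].

Section IntersectionGraph.
Variables (F : finFieldType) (V : vectType F).

Definition proper_nontrivial (W : {vspace V}) : bool :=
  (W != 0%VS) && (W != fullv).

Definition ig_vertex : finType := {W : {vspace V} | proper_nontrivial W}.

Definition ig_adj (U W : ig_vertex) : bool :=
  (U != W) && ((val U :&: val W)%VS != 0%VS).

Lemma ig_adj_sym : symmetric ig_adj.
Proof. by move=> U W; rewrite /ig_adj eq_sym capvC. Qed.

Lemma ig_adj_irr : irreflexive ig_adj.
Proof. by move=> U; rewrite /ig_adj eqxx. Qed.

Definition intersection_graph : sgraph := SGraph ig_adj_sym ig_adj_irr.

End IntersectionGraph.

Definition gauss_binom (q n t : nat) : rat :=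
  if t <= n then
    (\prod_(0 <= i < t) (((q ^ (n - i))%:R - 1) / ((q ^ (t - i))%:R - 1)))%R
  else 0%R.

(* Main.v *)
Require Import Defs.
From mathcomp Require Import all_boot all_order all_algebra all_field.
From mathcomp Require Import zify.

Set Implicit Arguments.
Unset Strict Implicit.
Unset Printing Implicit Defensive.

Import Order.TTheory GRing.Theory Num.Theory.

(** Let the dimension be 2m+1, and call a vertex big if its dimension exceeds m,
    small otherwise.  Two big subspaces have dimensions adding up to more than
    2m+1, so they meet: the big subspaces form a clique, and the chromatic number
    is at least the number of big subspaces.

    For the upper bound it is enough to have an injective map c from the set of
    all subspaces to itself such that c W is always a complement of W
    ([injective_complement]).  Since 2m+1 is odd, c exchanges big and small
    subspaces, so there are as many of one kind as of the other.  Colour a small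
    subspace by itself and a big one W by the small subspace c W: a colour is
    shared by at most two vertices, W and c W, which meet trivially.  Hence the
    chromatic number is the number of small nonzero subspaces, which is the sum
    of the Gaussian binomials of index 1 to m.

    The map c comes from Hall's marriage theorem ([hall_marriage]) applied to
    the relation of being complementary.  A d-dimensional subspace of an
    n-dimensional space has q^(d(n-d)) complements ([card_complements]), which is
    symmetric in d and n-d: complementary subspaces have equally many
    complements.  A double count shows that such a locally regular relation
    satisfies Hall's condition ([hall_condition_of_degrees]).

    Both counts, of the complements and of the k-dimensional subspaces
    ([card_subspaces]), go through tuples of vectors that are independent modulo
    a given subspace ([card_free_mod]): the tuples are chosen one vector at a
    time, and each subspace is then counted once for each of its bases
    ([card_by_span]). *)

(** * Hall's marriage theorem *)

Section Hall.
Variables S T : finType.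
Implicit Types (e : S -> T -> bool) (A B C : {set S}).

Definition nbhd e A : {set T} := [set y | [exists x in A, e x y]].

Lemma nbhdP e A y : reflect (exists2 x, x \in A & e x y) (y \in nbhd e A).
Proof. by rewrite inE; apply: exists_inP. Qed.

(** Halmos and Vaughan's induction on the size of [A].  If a proper nonempty part
    B of [A] has no neighbour to spare, B is matched inside its neighbourhood, and
    the rest of [A] still satisfies Hall's condition outside that neighbourhood.
    If there is no such B, any edge may be put in the matching, since removing
    its end in [T] costs each set at most the one neighbour it has to spare.  The
    point [y0] witnesses that [T] has elements even when [A] is empty. *)
Theorem hall_marriage (y0 : T) e A :
    (forall B, B \subset A -> #|B| <= #|nbhd e B|) ->
  exists f : S -> T, {in A, forall x, e x (f x)} /\ {in A &, injective f}.
Proof.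
have [m] := ubnP #|A|; elim: m e A => // m IHm e A ltAm hallA.
have [->|[a Aa]] := set_0Vmem A.
  by exists (fun=> y0); split=> [x|x y]; rewrite inE.
have [/existsP[B /and4P[BA B0 BnA]]|noB] := boolP [exists B : {set S},
    [&& B \subset A, B != set0, B != A & #|nbhd e B| <= #|B|]].
- move=> tightB.
  have ltBA : #|B| < #|A|.
    by apply: proper_card; rewrite properEneq BnA.
  have [||f1 [e1 inj1]] := IHm e B; first exact: leq_trans ltBA ltAm.
    by move=> D DB; apply: hallA; apply: subset_trans BA.
  pose e' x y := e x y && (y \notin nbhd e B).
  have ltCA : #|A :\: B| < #|A|.
    rewrite -(cardsID B A) (setIidPr BA) -{1}[#|A :\: B|]add0n ltn_add2r.
    by rewrite card_gt0.
  have [||f2 [e2 inj2]] := IHm e' (A :\: B); first exact: leq_trans ltCA ltAm.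
    move=> D; rewrite subsetD => /andP[DA DB].
    have := hallA (B :|: D); rewrite subUset BA DA => /(_ isT).
    rewrite cardsU disjoint_setI0 1?disjoint_sym // cards0 subn0 => le_BD.
    (* The neighbours of B and D together are those of B and those of D in e'. *)
    rewrite -(leq_add2l #|B|); apply: leq_trans le_BD _.
    apply: leq_trans (leq_add tightB (leqnn _)).
    apply: leq_trans (leq_card_setU _ _); apply/subset_leq_card/subsetP => y.
    case/nbhdP => x; rewrite !inE => /orP[xB|xD] exy.
      by apply/orP; left; apply/exists_inP; exists x.
    case: (boolP (y \in nbhd e B)) => yB; first by rewrite inE in yB; rewrite yB.
    by apply/orP; right; apply/exists_inP; exists x => //; rewrite /e' exy.
  exists (fun x => if x \in B then f1 x else f2 x); split=> [x xA|x y xA yA].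
    case: ifPn => xB; first exact: e1.
    by have /e2/andP[] : x \in A :\: B by rewrite inE xB.
  have sep u v : u \in B -> v \in A -> v \notin B -> f1 u <> f2 v.
    move=> uB vA vB uv; have /e2/andP[_] : v \in A :\: B by rewrite inE vB.
    by rewrite -uv => /nbhdP[]; exists u => //; apply: e1.
  case: ifPn => xB; case: ifPn => yB eqf.
  + exact: inj1.
  + by case: (sep x y).
  + by case: (sep y x).
  + by apply: inj2; rewrite // inE ?xB ?yB.
- have [y /nbhdP[_ /set1P-> eay]] : exists y, y \in nbhd e [set a].
    by apply/card_gt0P; rewrite -(cards1 a) hallA // sub1set.
  pose e' x z := e x z && (z != y).
  have ltCA : #|A :\ a| < #|A| by rewrite [X in _ < X](cardsD1 a) Aa.
  have [||f [ef injf]] := IHm e' (A :\ a); first exact: leq_trans ltCA ltAm.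
    move=> D; rewrite subsetD1 => /andP[DA aD].
    have [->|D0] := eqVneq D set0; first by rewrite cards0.
    have ltD : #|D| < #|nbhd e D|.
      have DnA : D != A by apply: contraNneq aD => ->.
      by move: noB; rewrite negb_exists => /forallP/(_ D); rewrite DA D0 DnA -ltnNge.
    rewrite -ltnS; apply: leq_trans ltD _.
    apply: leq_trans (_ : #|y |: nbhd e' D| <= _); last first.
      by rewrite cardsU1; case: (_ \notin _).
    apply/subset_leq_card/subsetP => z /nbhdP[x xD exz]; rewrite !inE.
    have [//|zy] := eqVneq z y.
    by apply/exists_inP; exists x => //; rewrite /e' exz.
  have A'in x : x \in A -> x != a -> x \in A :\ a by move=> xA xa; rewrite !inE xa.
  exists (fun x => if x == a then y else f x); split=> [x xA|x z xA zA].
    by case: eqVneq => [->//|xa]; case/andP: (ef x (A'in _ xA xa)).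
  have neq u : u \in A -> u != a -> f u != y.
    by move=> uA ua; case/andP: (ef u (A'in _ uA ua)).
  case: (eqVneq x a) => [->|xa]; case: (eqVneq z a) => [->|za] // eqf.
  + by have := neq z zA za; rewrite -eqf eqxx.
  + by have := neq x xA xa; rewrite eqf eqxx.
  + by apply: injf => //; apply: A'in.
Qed.

(** Each point of [S] distributes a total weight 1 equally over its edges.  An edge
    into y then carries at most the inverse of the degree of y, so y receives at
    most 1, and the weight #|A| sent out of [A] is at most the number of
    receivers.  Degrees are compared along edges only, because the number of
    complements of a subspace varies with its dimension. *)
Lemma hall_condition_of_degrees e A :
    (forall x, 0 < #|[set y | e x y]|) ->
    (forall x y, e x y -> #|[set x' | e x' y]| <= #|[set y' | e x y']|) ->
  #|A| <= #|nbhd e A|.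
Proof.
move=> deg_gt0 le_deg; rewrite -(ler_nat rat) -!sum1_card !natr_sum.
pose w x : rat := ((#|[set y | e x y]|)%:R^-1)%R.
have wsum x : (\sum_(y | e x y) w x = 1)%R.
  rewrite sumr_const -(eq_card (fun y => in_set (e x) y)) -[(w x *+ _)%R]mulr_natr.
  by rewrite mulVf // pnatr_eq0 -lt0n.
rewrite (eq_bigr (fun x => \sum_(y | e x y) w x)%R) => [|x _]; last by rewrite wsum.
rewrite (exchange_big_dep (mem (nbhd e A))) /=; last first.
  by move=> x y xA exy; apply/nbhdP; exists x.
apply: ler_sum => y /nbhdP[x0 x0A ex0].
pose N := #|[set x | e x y]|.
have N_gt0 : 0 < N by apply/card_gt0P; exists x0; rewrite inE.
apply: (@le_trans _ _ (\sum_(x | e x y) N%:R^-1)%R).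
  rewrite [leRHS](bigID (mem A)) /= -[leLHS]addr0; apply: lerD; last first.
    by apply: sumr_ge0 => x _; rewrite invr_ge0 ler0n.
  rewrite (eq_bigl (fun x => e x y && (x \in A))) => [|x]; last exact: andbC.
  apply: ler_sum => x /andP[exy _].
  by rewrite lef_pV2 ?qualifE /= ?ltr0n // ler_nat le_deg.
rewrite sumr_const -(eq_card (fun x => in_set (e^~ y) x)) -[(_ *+ _)%R]mulr_natr.
by rewrite mulVf // pnatr_eq0 -lt0n.
Qed.

End Hall.

(** * Counting subspaces over a finite field *)

Section Counting.
Variables (F : finFieldType) (V : vectType F).
Implicit Types (U W X : {vspace V}) (v : V) (t : seq V).
Local Notation q := #|F|.
Local Notation n := (\dim {:V}).
Local Notation fV := (finvect_type V).

(* [fV] is the type V seen as a finite type: tuples are taken in [fV] so that they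
   can be counted, and their entries are read in V. *)

Lemma card_vectors U : #|[pred v : fV | (v : V) \in U]| = q ^ \dim U.
Proof. by case: V U => T c U; apply: (@card_vspace _ (finvect_type (Vector.Pack c))). Qed.

(** The images of [t] in the quotient by [U] are linearly independent. *)
Definition free_mod U t := \dim (U + <<t>>) == \dim U + size t.

Lemma free_mod_cons U v t :
  free_mod U (v :: t) = (v \notin U) && free_mod (U + <[v]>) t.
Proof.
rewrite /free_mod span_cons addvA /=.
have le1 : \dim (U + <[v]> + <<t>>) <= \dim (U + <[v]>) + size t.
  by rewrite (leq_trans (dimv_add_leqif _ _)) // leq_add2l dim_span.
have [vU|vU] /= := boolP (v \in U).
  have Uv : (U + <[v]> = U)%VS by apply/addv_idPl; rewrite -memvE.
  by rewrite Uv in le1 *; apply: contraTF le1 => /eqP->; rewrite addnS -ltnNge.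
suff -> : \dim (U + <[v]>) = (\dim U).+1 by rewrite addSnnS.
rewrite dimv_disjoint_sum ?dim_vline.
  by rewrite (contraNneq _ vU) ?addn1 // => ->; apply: mem0v.
apply/eqP; rewrite -subv0; apply/subvP => x; rewrite memv_cap => /andP[xU].
case/vlineP => k kx; move: xU; rewrite kx.
have [->|k0] := eqVneq k 0%R; first by rewrite scale0r !mem0v.
by rewrite rpredZeq (negPf k0) (negPf vU).
Qed.

(** The next vector of the tuple is any vector of [X] outside the span of [U] and
    of the vectors already chosen. *)
Lemma card_free_mod U X k : (U <= X)%VS ->
  #|[pred t : k.-tuple fV | (<<(t : seq V)>> <= X)%VS && free_mod U t]|
    = \prod_(j < k) (q ^ \dim X - q ^ (\dim U + j)).
Proof.
elim: k U => [|k IHk] U UX.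
  rewrite big_ord0 (eq_card (_ : _ =i predT)) ?card_tuple // => t.
  by rewrite !inE tuple0 span_nil sub0v /free_mod span_nil addv0 addn0 eqxx.
pose D := [pred v : fV | ((v : V) \in X) && ((v : V) \notin U)].
have cardD : #|D| = q ^ \dim X - q ^ \dim U.
  rewrite -!card_vectors -(cardID [pred v : fV | (v : V) \in U]
    [pred v : fV | (v : V) \in X]).
  rewrite [X in X + _ - _](eq_card (B := [pred v : fV | (v : V) \in U])) => [|v].
    by rewrite addKn; apply: eq_card => v; rewrite !inE andbC.
  by rewrite !inE andb_idl // => /(subvP UX).
rewrite -sum1_card (partition_big (@thead k fV) (mem D)) /= => [|t]; last first.
  rewrite {1}(tuple_eta t) !inE /= free_mod_cons span_cons subv_add -memvE.
  by case/andP => /andP[-> _] /andP[].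
rewrite (eq_bigr (fun=> \prod_(j < k) (q ^ \dim X - q ^ (\dim U + j.+1)))).
  by rewrite sum_nat_const cardD big_ord_recl /= addn0.
move=> v /andP[vX vU].
rewrite (reindex_onto (fun t : k.-tuple fV => cons_tuple v t)
  (@behead_tuple k.+1 fV)) /=; last first.
  move=> t /andP[_ /eqP <-]; apply: val_inj => /=.
  by rewrite [in RHS](tuple_eta t).
rewrite (eq_bigl (mem [pred t : k.-tuple fV |
    (<<(t : seq V)>> <= X)%VS && free_mod (U + <[v : V]>)%VS t])); last first.
  move=> t; rewrite !inE /= free_mod_cons span_cons subv_add -memvE vX vU theadE.
  by rewrite eqxx andbT /= (_ : _ == t) ?andbT //; apply/eqP/val_inj.
rewrite sum1_card IHk ?subv_add ?UX -?memvE //.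
suff -> : \dim (U + <[v : V]>) = (\dim U).+1.
  by apply: eq_bigr => j _; rewrite addSnnS.
have := free_mod_cons U v [::].
rewrite vU /free_mod span_nil !addv0 addn0 eqxx span_seq1 /= addn1.
by move/eqP.
Qed.

(** The product is the number of ordered bases of a k-dimensional space.  With [Q]
    arbitrary, the lemma serves to count both all the subspaces of a dimension
    and the complements of one subspace. *)
Lemma card_by_span k (Q : pred {vspace V}) :
  #|[pred t : k.-tuple fV | free (t : seq V) && Q <<(t : seq V)>>%VS]|
    = #|[pred X : {vspace V} | (\dim X == k) && Q X]|
      * \prod_(j < k) (q ^ k - q ^ j).
Proof.
rewrite -sum1_card (partition_big (fun t : k.-tuple fV => <<(t : seq V)>>%VS)
  (mem [pred X : {vspace V} | (\dim X == k) && Q X])) /=; last first.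
  by move=> t /andP[ft Qt]; rewrite inE Qt andbT; move: ft; rewrite /free size_tuple.
rewrite -sum_nat_const; apply: eq_bigr => X /andP[/eqP dimX QX].
have := card_free_mod k (sub0v X); rewrite dimv0 dimX => <-.
rewrite -sum1_card; apply: eq_bigl => t; rewrite !inE /free_mod dimv0 add0v.
rewrite /free size_tuple; apply/andP/andP => [[/andP[ft _] /eqP<-]|[tX ft]].
  by rewrite subvv.
have eqX : <<(t : seq V)>>%VS = X.
  by apply/eqP; rewrite -(dimv_leqif_eq tX) dimX.
by rewrite eqX QX eqxx dimX eqxx.
Qed.

Lemma prod_expB_gt0 k : 0 < \prod_(j < k) (q ^ k - q ^ j).
Proof. by apply/prodn_gt0 => j; rewrite subn_gt0 ltn_exp2l ?finNzRing_gt1. Qed.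

(** A basis of a complement of [U] is the same as a maximal tuple free modulo [U].
    With d the dimension of [U] and k = n - d, there are
    prod_(j < k) (q^n - q^(d + j)) such tuples, that is q^(d k) times the number of
    bases of each complement. *)
Lemma card_complements U :
  #|[set W | (\dim U + \dim W == n) && (U :&: W == 0)%VS]|
    = q ^ (\dim U * (n - \dim U)).
Proof.
set d : nat := \dim U; set k := n - d.
have dn : d + k = n by rewrite subnKC ?dimvS ?subvf.
apply/eqP; rewrite -(eqn_pmul2r (prod_expB_gt0 k)); apply/eqP.
transitivity (\prod_(j < k) (q ^ n - q ^ (d + j))); last first.
  have <- : \prod_(j < k) q ^ d = q ^ (d * k).
    by rewrite prod_nat_const card_ord expnM.
  by rewrite -big_split /=; apply: eq_bigr => j _; rewrite mulnBr -!expnD dn.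
rewrite -card_free_mod ?subvf //.
transitivity #|[pred t : k.-tuple fV |
    free (t : seq V) && (U :&: <<(t : seq V)>> == 0)%VS]|.
  rewrite (card_by_span k (fun W => U :&: W == 0)%VS); congr (_ * _).
  by apply: eq_card => W; rewrite !inE -dn eqn_add2l.
apply: eq_card => t; rewrite !inE subvf /free_mod /free /=.
have := dim_span (t : seq V); have := dimv_sum_cap U <<(t : seq V)>>%VS.
rewrite -dimv_eq0 -[0%R]/0%N -/d.
clearbody d; move: (size _) (\dim (U + _)) (\dim (U :&: _)) (\dim <<_>>) => *; lia.
Qed.

(** In the quotient of the number of free k-tuples of V by the number of bases of a
    k-dimensional space, the powers q^j taken out of the factors q^n - q^j and
    q^k - q^j cancel, which leaves the Gaussian binomial. *)
Lemma card_subspaces k : k <= n ->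
  (#|[set W : {vspace V} | \dim W == k]|)%:R%R = gauss_binom q n k.
Proof.
move=> kn; have := card_by_span k predT.
rewrite (eq_card (B := [pred t : k.-tuple fV |
    (<<(t : seq V)>> <= {:V})%VS && free_mod 0%VS t])); last first.
  by move=> t; rewrite !inE subvf andbT /free_mod add0v dimv0.
rewrite card_free_mod ?subvf // dimv0.
rewrite (eq_card (B := [set W : {vspace V} | \dim W == k])); last first.
  by move=> W; rewrite !inE andbT.
move=> eqN; rewrite /gauss_binom kn big_mkord prodf_div.
have q0 : (q%:R != 0 :> rat)%R by rewrite pnatr_eq0 -lt0n ltnW ?finNzRing_gt1.
(* For m = n and m = k, [fac] takes the powers of q out of the two products. *)
have fac m : k <= m -> ((\prod_(j < k) (q ^ m - q ^ j)) %:R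
   = (\prod_(j < k) (q ^ j)%:R) * \prod_(i < k) ((q ^ (m - i))%:R - 1) :> rat)%R.
  move=> km; rewrite natr_prod -big_split /=; apply: eq_bigr => j _.
  have jm : j <= m := leq_trans (ltnW (ltn_ord j)) km.
  rewrite natrB ?leq_pexp2l // ?(ltnW (finNzRing_gt1 F)) //.
  by rewrite mulrBr mulr1 -natrM -expnD subnKC.
have := congr1 (fun x : nat => x%:R%R : rat) eqN; rewrite natrM !fac //.
have h0 : (\prod_(j < k) (q ^ j)%:R != 0 :> rat)%R.
  by apply/prodf_neq0 => j _; rewrite natrX expf_neq0.
have h1 : (\prod_(i < k) ((q ^ (k - i))%:R - 1) != 0 :> rat)%R.
  apply/prodf_neq0 => j _; rewrite subr_eq0 pnatr_eq1 -(expn0 q).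
  by rewrite eqn_exp2l ?finNzRing_gt1 // subn_eq0 -ltnNge.
move=> e; apply: (mulIf h1); rewrite divfK //; apply: (mulfI h0).
by rewrite e mulrCA.
Qed.

(** Complementary subspaces have as many complements as each other, so the relation
    is locally regular and Hall's theorem applies to all the subspaces at once,
    whatever their dimensions. *)
Lemma injective_complement :
  exists c : {vspace V} -> {vspace V}, injective c /\
    forall W, \dim W + \dim (c W) = n /\ (W :&: c W = 0)%VS.
Proof.
pose e W X := (\dim W + \dim X == n) && (W :&: X == 0)%VS.
have degE W : #|[set X | e W X]| = q ^ (\dim W * (n - \dim W)).
  exact: card_complements.
have e_sym W X : e W X = e X W by rewrite /e addnC capvC.
have [B _|c [ec inj_c]] := hall_marriage 0%VS (e := e) (A := setT).
- apply: hall_condition_of_degrees => [W|W X eWX].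
    by rewrite degE expn_gt0 (ltnW (finNzRing_gt1 F)).
  rewrite (_ : [set _ | _] = [set W' | e X W']); last first.
    by apply/setP => W'; rewrite !inE e_sym.
  rewrite !degE; case/andP: eWX => /eqP<- _.
  by rewrite addKn addnK mulnC.
exists c; split=> [W X|W]; first by apply: inj_c; rewrite inE.
by have /andP[/eqP-> /eqP->] := ec W (in_setT W).
Qed.

End Counting.

(** * Bounds on the chromatic number *)

Lemma leq_clique_chrom_num (G : sgraph) (K : {set G}) :
  {in K &, forall u v, u != v -> adj u v} -> #|K| <= chrom_num G.
Proof.
move=> clique; have [[f [/forallP pf <-]] _] := chrom_numP G.
have inj_f : {in enum K &, injective f}.
  move=> u v; rewrite !mem_enum => uK vK; apply: contra_eq => uv.
  by apply: (implyP (forallP (pf u) v)); apply: clique.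
rewrite cardE -(size_map f); apply: uniq_leq_size.
  by rewrite map_inj_in_uniq ?enum_uniq.
by move=> _ /mapP[x _ ->]; rewrite mem_undup codom_f.
Qed.

Lemma chrom_num_leq (G : sgraph) (C : finType) (f : G -> C) (P : {set C}) :
    (forall u v, adj u v -> f u != f v) -> (forall u, f u \in P) ->
  chrom_num G <= #|P|.
Proof.
move=> pf fP; have [_ le_chrom] := chrom_numP G.
apply: leq_trans (le_chrom _ f _) _.
  by apply/forallP => u; apply/forallP => v; apply/implyP/pf.
rewrite cardE; apply: uniq_leq_size (undup_uniq _) _.
by move=> z; rewrite mem_undup mem_enum => /codomP[x ->].
Qed.

(** * Intersection graphs in odd dimension *)

Section OddDimension.
Variables (F : finFieldType) (V : vectType F) (m : nat).
Hypothesis dimV : \dim {:V} = m.*2.+1.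

Let small := [set W : {vspace V} | 0 < \dim W <= m].
Let big := [set W : {vspace V} | m < \dim W < m.*2.+1].

Lemma proper_nontrivialE (W : {vspace V}) :
  proper_nontrivial W = (W \in small :|: big).
Proof.
rewrite !inE /proper_nontrivial -dimv_eq0 -lt0n -dimV.
rewrite (_ : (W != fullv) = (\dim W < \dim {:V})); last first.
  by rewrite (ltn_leqif (dimv_leqif_eq (subvf W))).
by rewrite dimV; move: (\dim W) => d; lia.
Qed.

(** The injective complement map serves twice: it colours the big vertices with
    small subspaces, and it sends the small subspaces into the clique of big
    vertices. *)
Lemma chrom_num_card_small : chrom_num (intersection_graph V) = #|small|.
Proof.
have [c [inj_c cP]] := injective_complement V.
have dim_c W : \dim (c W) = m.*2.+1 - \dim W.
  by case: (cP W) => e _; rewrite -dimV -e addKn.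
apply/eqP; rewrite eqn_leq; apply/andP; split.
  pose col (v : intersection_graph V) :=
    if \dim (val v) <= m then val v else c (val v).
  apply: (@chrom_num_leq _ _ col) => [u v /andP[uv cap_uv]|v].
    rewrite /col; case: leqP => mu; case: leqP => mv.
    - by rewrite val_eqE.
    - apply: contraNneq cap_uv => ->; rewrite capvC.
      by have [_ ->] := cP (val v).
    - apply: contraNneq cap_uv => <-.
      by have [_ ->] := cP (val u).
    - by rewrite (inj_eq inj_c) val_eqE.
  have := valP v; rewrite /= proper_nontrivialE !inE /col.
  by case: (leqP (\dim (val v)) m); rewrite ?dim_c; move: (\dim _) => d; lia.
apply: leq_trans (_ : #|[set v : intersection_graph V | val v \in big]| <= _).
  rewrite -(card_imset _ inj_c) -[X in _ <= X](card_imset _ val_inj).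
  apply/subset_leq_card/subsetP => _ /imsetP[W + ->]; rewrite inE => /andP[W0 Wm].
  have cW_big : c W \in big.
    by rewrite inE dim_c; move: (\dim W) W0 Wm => d; lia.
  have cW_vertex : proper_nontrivial (c W).
    by rewrite proper_nontrivialE inE cW_big orbT.
  by apply/imsetP; exists (exist _ (c W) cW_vertex) => //; rewrite inE.
(* Two subspaces of dimension above m meet: 2 (m + 1) > 2 m + 1. *)
apply: leq_clique_chrom_num => u v; rewrite !inE => /andP[mu _] /andP[mv _] uv.
rewrite /= /ig_adj uv /= -dimv_eq0 -lt0n.
rewrite -(ltn_add2l (\dim (val u + val v))) dimv_sum_cap addn0.
apply: leq_ltn_trans (dimvS (subvf _)) _; rewrite dimV -addnn -addSn.
by apply: leq_trans (leq_add mu mv); rewrite addSn addnS.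
Qed.

Lemma card_small_gauss_binom :
  (#|small|)%:R%R = (\sum_(1 <= i < m.+1) gauss_binom #|F| m.*2.+1 i)%R.
Proof.
rewrite -sum1_card (partition_big (fun W : {vspace V} => inord (\dim W) : 'I_m.+1)
  (fun i => 0 < i)) /=; last first.
  by move=> W; rewrite inE => /andP[W0 Wm]; rewrite inordK.
rewrite big_mkcond big_ord_recl /= add0n natr_sum big_add1 /= big_mkord.
apply: eq_bigr => i _; rewrite -dimV -card_subspaces; last first.
  by rewrite dimV ltnS (leq_trans (ltnW (ltn_ord i))) // -addnn leq_addr.
congr _%:R%R; rewrite -sum1_card; apply: eq_bigl => W; rewrite !inE.
apply/andP/eqP => [[/andP[W0 Wm] /eqP/(congr1 val)]|Wi].
  by rewrite /= inordK.
by rewrite Wi /= ltn_ord; split=> //; apply/eqP/val_inj; rewrite /= inordK ?ltnS.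
Qed.

End OddDimension.

Theorem corollary8 (F : finFieldType) (q : nat) (hq : #|F| = q)
    (V : vectType F) (n : nat) (hn : \dim {:V} = n) (hodd : odd n) :
  (chrom_num (intersection_graph V))%:R%R
    = (\sum_(1 <= i < (n %/ 2).+1) gauss_binom q n i)%R :> rat.
Proof.
have n_odd : n = (n %/ 2).*2.+1 by rewrite divn2 -[LHS]odd_double_half hodd.
have dimV : \dim {:V} = (n %/ 2).*2.+1 by rewrite hn.
by rewrite (chrom_num_card_small dimV) (card_small_gauss_binom dimV) hq -n_odd.
Qed.
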